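(* Fix an integer $k\ge1$. The following are equivalent: (i) for every $e^\star\in\mathcal H$ with $\|e^\star\|_{0,\mathrm g}\le k$, the vector $e^\star$ is the unique solution of $Be=Be^\star$ among all $e\in\mathcal H$ satisfying $\|e\|_{0,\mathrm g}\le k$; (ii) $\ker B$ contains no nonzero vector $h$ with $\|h\|_{0,\mathrm g}\le 2k$; (iii) $\gamma_k(D,A)>0$; (iv) $\operatorname{spark}_{\mathrm g}(B)>2k$.
   Context: Let $G=(V,E)$ be a finite directed multigraph with $V=\{1,\dots,n\}$. Each node $i$ carries a finite-dimensional real Hilbert space $\mathcal H_i$; $\mathcal H=\bigoplus_{i=1}^n\mathcal H_i$ (with $\mathcal H\neq\{0\}$), with norm $\|h\|_2^2=\sum_i\|h_i\|^2$. The group sparsity of $h\in\mathcal H$ is $\|h\|_{0,\mathrm g}=|\{i\in V:h_i\ne0\}|$. Each edge $e=(i,j)$ carries a weight $w_e>0$ and a linear map $T_e:\mathcal H_i\to\mathcal H_j$, and $D$ is the linear operator $(Dz)_e=\sqrt{w_e}(z_j-T_ez_i)$, $e=(i,j)\in E$. $A:\mathcal H\to\mathcal K$ is a linear map into a finite-dimensional real Hilbert space. $B$ is the stacked operator $Bh=(Dh,\,Ah)$, so $\|Bh\|_2^2=\|Dh\|_2^2+\|Ah\|_2^2$. The margin is $$\gamma_k(D,A)=\min_{h\ne0,\ \|h\|_{0,\mathrm g}\le2k}\frac{\|Bh\|_2}{\|h\|_2}.$$ The group spark is $\operatorname{spark}_{\mathrm g}(B)=\min\{\|h\|_{0,\mathrm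 g}:h\neq0,\ Bh=0\}$, with value $+\infty$ if $B$ is injective. *)

(* Defs.v *)
From HB Require Import structures.
From mathcomp Require Import all_boot all_order all_algebra.
From mathcomp Require Import all_classical all_reals all_analysis.

Set Implicit Arguments.
Unset Strict Implicit.
Unset Printing Implicit Defensive.

Import Order.TTheory GRing.Theory Num.Theory.
Local Open Scope classical_set_scope.
Local Open Scope ring_scope.

(* The least element of S; x0 is returned when S has none. *)
Definition setmin {d : Order.disp_t} {T : porderType d} (x0 : T) (S : set T) : T :=
  xget x0 (S `&` lbound S).

(* External direct sum of a finite family of modules. MathComp only provides
   the module structure on non-dependent finite functions. *)
Definition dsum {R : pzRingType} {I : finType} (V : I -> lmodType R) : Type :=
  {dffun forall i, V i}.

Section DirectSum.
Context {R : pzRingType} {I : finType} (V : I -> lmodType R).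

HB.instance Definition _ := Choice.copy (dsum V) {dffun forall i, V i}.

Definition dsum_zero : dsum V := [ffun i => 0 : V i].
Definition dsum_opp (f : dsum V) : dsum V := [ffun i => - f i].
Definition dsum_add (f g : dsum V) : dsum V := [ffun i => f i + g i].
Definition dsum_scale (a : R) (f : dsum V) : dsum V := [ffun i => a *: f i].

Fact dsum_addA : associative dsum_add.
Proof. by move=> f g h; apply/ffunP => i; rewrite !ffunE addrA. Qed.
Fact dsum_addC : commutative dsum_add.
Proof. by move=> f g; apply/ffunP => i; rewrite !ffunE addrC. Qed.
Fact dsum_add0 : left_id dsum_zero dsum_add.
Proof. by move=> f; apply/ffunP => i; rewrite !ffunE add0r. Qed.
Fact dsum_addN : left_inverse dsum_zero dsum_opp dsum_add.
Proof. by move=> f; apply/ffunP => i; rewrite !ffunE addNr. Qed.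

HB.instance Definition _ := GRing.isZmodule.Build (dsum V)
  dsum_addA dsum_addC dsum_add0 dsum_addN.

Fact dsum_scaleA a b (f : dsum V) :
  dsum_scale a (dsum_scale b f) = dsum_scale (a * b) f.
Proof. by apply/ffunP => i; rewrite !ffunE scalerA. Qed.
Fact dsum_scale1 : left_id 1 dsum_scale.
Proof. by move=> f; apply/ffunP => i; rewrite !ffunE scale1r. Qed.
Fact dsum_scaleDr : right_distributive dsum_scale +%R.
Proof. by move=> a f g; apply/ffunP => i; rewrite !ffunE scalerDr. Qed.
Fact dsum_scaleDl (f : dsum V) : {morph dsum_scale^~ f : a b / a + b}.
Proof. by move=> a b; apply/ffunP => i; rewrite !ffunE scalerDl. Qed.

HB.instance Definition _ := GRing.Zmodule_isLmodule.Build R (dsum V)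
  dsum_scaleA dsum_scale1 dsum_scaleDr dsum_scaleDl.

Lemma dsum0E i : (0 : dsum V) i = 0. Proof. exact: ffunE. Qed.
Lemma dsumDE (f g : dsum V) i : (f + g) i = f i + g i. Proof. exact: ffunE. Qed.
Lemma dsumZE a (f : dsum V) i : (a *: f) i = a *: f i. Proof. exact: ffunE. Qed.

Definition gsparsity (h : dsum V) : nat := #|[set i | h i != 0]%SET|.

End DirectSum.

(* A finite-dimensional real Hilbert space is a vectType over R together with
   a positive definite symmetric bilinear form [ip : {dot V for idfun}];
   completeness is automatic in finite dimension. *)
Section HilbertNorms.
Context {R : realType}.

Definition hnorm {V : lmodType R} (ip : {dot V for idfun}) (v : V) : R :=
  Num.sqrt (ip v v).

Definition dsum_norm {I : finType} {V : I -> lmodType R}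
    (ip : forall i, {dot (V i) for idfun}) (h : dsum V) : R :=
  Num.sqrt (\sum_i hnorm (ip i) (h i) ^+ 2).

End HilbertNorms.

(* A directed multigraph is given by its edge type E and the endpoint maps
   src, tgt: an edge e goes from src e to tgt e; loops and parallel edges
   are allowed. *)
Section EdgeOperator.
Context {R : realType} {n : nat} {H : 'I_n -> vectType R} {E : finType}
        {src tgt : E -> 'I_n}.
Variables (w : E -> R) (T : forall e, {linear H (src e) -> H (tgt e)}).

Definition edge_op (z : dsum H) : dsum (fun e => H (tgt e)) :=
  [ffun e => Num.sqrt (w e) *: (z (tgt e) - T e (z (src e)))].

Fact edge_op_linear : linear edge_op.
Proof.
move=> a u v; apply/ffunP => e; rewrite !ffunE.
by rewrite linearP opprD addrACA -scalerBr scalerDr !scalerA [a * _]mulrC.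
Qed.

HB.instance Definition _ :=
  GRing.isLinear.Build R (dsum H) (dsum (fun e => H (tgt e))) _ edge_op
    edge_op_linear.

End EdgeOperator.

Section StackedOperator.
Context {R : realType} {U X Y : lmodType R}.
Variables (D : {linear U -> X}) (A : {linear U -> Y}).

Definition stack_op (h : U) : X * Y := (D h, A h).

Fact stack_op_linear : linear stack_op.
Proof. by move=> a u v; rewrite /stack_op !linearP. Qed.

HB.instance Definition _ :=
  GRing.isLinear.Build R U (X * Y)%type _ stack_op stack_op_linear.

End StackedOperator.

Section MarginAndSpark.
Context {R : realType} {n : nat} {H : 'I_n -> vectType R}.

Definition stack_norm {I : finType} {X : I -> lmodType R} {Y : lmodType R}
    (ipX : forall i, {dot (X i) for idfun}) (ipY : {dot Y for idfun})
    (y : dsum X * Y) : R :=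
  Num.sqrt (dsum_norm ipX y.1 ^+ 2 + hnorm ipY y.2 ^+ 2).

(* The minimum is attained as soon as H is nonzero and k > 0, so the default
   value 0 plays no role there. *)
Definition margin {E : finType} {tgt : E -> 'I_n} {K : vectType R}
    (ipH : forall i, {dot (H i) for idfun}) (ipK : {dot K for idfun})
    (D : {linear dsum H -> dsum (fun e => H (tgt e))})
    (A : {linear dsum H -> K}) (k : nat) : R :=
  setmin 0
    [set stack_norm (fun e => ipH (tgt e)) ipK (stack_op D A h)
           / dsum_norm ipH h
     | h in [set h : dsum H | h != 0 /\ (gsparsity h <= 2 * k)%N]].

(* The default value +oo is returned exactly when B is injective. *)
Definition gspark {Y : lmodType R} (B : {linear dsum H -> Y}) : \bar R :=
  setmin +oo%E
    [set ((gsparsity h)%:R)%:E | h in [set h : dsum H | h != 0 /\ B h = 0]].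

End MarginAndSpark.

(* Main.v *)
(* (i) => (ii): a kernel vector with at most 2k nonzero blocks is a difference
   of two vectors with at most k nonzero blocks each.
   (ii) => (iii): the ratio is homogeneous of degree 0 and continuous off the
   origin, and the vectors with at most 2k nonzero blocks form a closed cone, so
   by compactness the ratio attains its minimum; a minimizer is not in ker B.
   (iii) => (iv): a kernel vector with at most 2k nonzero blocks would have
   ratio 0.
   (iv) => (i): two k-sparse solutions differ by a 2k-sparse kernel vector. *)
Require Import Defs.
From HB Require Import structures.
From mathcomp Require Import all_boot all_order all_algebra.
From mathcomp Require Import all_classical all_reals all_analysis.

Set Implicit Arguments.
Unset Strict Implicit.
Unset Printing Implicit Defensive.

Import Order.TTheory GRing.Theory Num.Theory.
Local Open Scope classical_set_scope.
Local Open Scope ring_scope.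

Import numFieldNormedType.Exports VectorInternalTheory.

(** * Supports and group sparsity in a direct sum *)

Section DirectSumTheory.
Context {R : pzRingType} {I : finType} {V : I -> lmodType R}.
Implicit Types h g : dsum V.

Lemma dsumNE h i : (- h) i = - h i. Proof. exact: ffunE. Qed.

Lemma dsum_neq0P h : reflect (exists i, h i != 0) (h != 0).
Proof.
apply: (iffP idP) => [h0|[i]]; last by apply: contraNneq => ->; rewrite dsum0E.
apply: contrapT => noi; move/eqP: h0; apply; apply/ffunP => i.
by rewrite dsum0E; apply/eqP; apply: contrapT => /negP ?; apply: noi; exists i.
Qed.

Lemma gsparsityB h g : (gsparsity (h - g)%R <= gsparsity h + gsparsity g)%N.
Proof.
apply: leq_trans (leq_card_setU [set i | h i != 0]%SET [set i | g i != 0]%SET).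
apply/subset_leq_card/fintype.subsetP => i.
rewrite !inE dsumDE dsumNE -negb_and; apply: contraNN => /andP[/eqP-> /eqP->].
by rewrite subr0.
Qed.

(** Keep up to [s] of the nonzero blocks of [h] in [g1]; then [g2 = g1 - h] carries the remaining
    ones with opposite sign. A difference is used so that [B h = 0] reads [B g1 = B g2]. *)
Lemma gsparsity_split h s t : (gsparsity h <= s + t)%N ->
  exists g1 g2, [/\ (gsparsity g1 <= s)%N, (gsparsity g2 <= t)%N & h = g1 - g2].
Proof.
move=> hst; pose S := [set i | h i != 0]%SET.
(* [r] lists distinct indices of the support; the minimum covers a support smaller than [s]. *)
have /card_geqP[r [ur sr rS]] : (minn s #|S| <= #|S|)%N by exact: geq_minr.
pose g1 : dsum V := [ffun i => if i \in r then h i else 0].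
exists g1, (g1 - h); split; last by rewrite subKr.
- apply: leq_trans (geq_minl s #|S|); rewrite -sr -(card_uniqP ur).
  apply/subset_leq_card/fintype.subsetP => i; rewrite inE ffunE.
  by case: ifP => //; rewrite eqxx.
- have : (#|S :\: [set i | i \in r]%SET| <= t)%N.
    rewrite cardsD (_ : S :&: _ = [set i | i \in r]%SET); last first.
      apply/finset.setP => i; rewrite finset.in_setI !inE.
      by apply/andb_idl => /rS; rewrite inE.
    rewrite [X in (_ - X)%N](_ : _ = minn s #|S|); last first.
      by rewrite cardsE (card_uniqP ur).
    rewrite leq_subLR; have [_|_] := leqP #|S| s; first exact: leq_addr.
    exact: hst.
  apply/leq_trans/subset_leq_card/fintype.subsetP => i; rewrite !inE dsumDE dsumNE ffunE.
  by case: ifP => ir; rewrite ?subrr ?eqxx// sub0r oppr_eq0.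
Qed.

(** Evaluation at [i] as a linear map, so that it can be composed with other linear maps. *)
Definition dsum_proj i h : V i := h i.

Fact dsum_proj_linear i : linear (dsum_proj i).
Proof. by move=> a h g; rewrite /dsum_proj dsumDE dsumZE. Qed.

HB.instance Definition _ i :=
  GRing.isLinear.Build R (dsum V) (V i) _ (dsum_proj i) (dsum_proj_linear i).

End DirectSumTheory.

Lemma gsparsityZ {R : fieldType} {I : finType} {V : I -> lmodType R} a (h : dsum V) :
  a != 0 -> gsparsity (a *: h) = gsparsity h.
Proof.
move=> a0; apply: eq_card => i.
by rewrite !inE dsumZE scaler_eq0 negb_or a0.
Qed.

(** * Homogeneity and positivity of the norms *)

Section NormTheory.
Context {R : realType}.

Lemma hnormZ {V : lmodType R} (b : {dot V for idfun}) a v :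
  hnorm b (a *: v) = `|a| * hnorm b v.
Proof.
rewrite /hnorm linearZl_LR linearZr_LR /= mulrA -expr2.
by rewrite sqrtrM ?sqr_ge0// sqrtr_sqr.
Qed.

Lemma hnorm_gt0 {V : lmodType R} (b : {dot V for idfun}) v :
  v != 0 -> 0 < hnorm b v.
Proof. by move=> v0; rewrite sqrtr_gt0; exact: neq0_dnorm_gt0. Qed.

Lemma dsum_normZ {I : finType} {V : I -> lmodType R}
    (ip : forall i, {dot (V i) for idfun}) a (h : dsum V) :
  dsum_norm ip (a *: h) = `|a| * dsum_norm ip h.
Proof.
rewrite /dsum_norm -[in RHS](sqrtr_sqr a) -sqrtrM ?sqr_ge0//; congr Num.sqrt.
rewrite mulr_sumr; apply: eq_bigr => i _.
by rewrite dsumZE hnormZ exprMn real_normK ?num_real.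
Qed.

Lemma dsum_norm_gt0 {I : finType} {V : I -> lmodType R}
    (ip : forall i, {dot (V i) for idfun}) (h : dsum V) :
  h != 0 -> 0 < dsum_norm ip h.
Proof.
move=> /dsum_neq0P[i hi]; rewrite sqrtr_gt0 (bigD1 i)//=.
by rewrite ltr_pwDl ?exprn_gt0 ?hnorm_gt0// sumr_ge0// => j _; rewrite sqr_ge0.
Qed.

Context {I : finType} {X : I -> lmodType R} {Y : lmodType R}.
Variables (ipX : forall i, {dot (X i) for idfun}) (ipY : {dot Y for idfun}).

Lemma stack_normZ a (y : dsum X * Y) :
  stack_norm ipX ipY (a *: y) = `|a| * stack_norm ipX ipY y.
Proof.
rewrite /stack_norm -[in RHS](sqrtr_sqr a) -sqrtrM ?sqr_ge0//; congr Num.sqrt.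
by rewrite /= dsum_normZ hnormZ !exprMn real_normK ?num_real// mulrDr.
Qed.

Lemma stack_norm_gt0 (y : dsum X * Y) : y != 0 -> 0 < stack_norm ipX ipY y.
Proof.
case: y => y z; rewrite xpair_eqE negb_and sqrtr_gt0 => /orP[y0|z0] /=.
  by rewrite ltr_pwDl ?sqr_ge0// exprn_gt0 ?dsum_norm_gt0.
by rewrite ltr_wpDl ?sqr_ge0// exprn_gt0 ?hnorm_gt0.
Qed.

End NormTheory.

(** * Continuity of norms along linear maps defined on row vectors *)

Section Continuity.
Context {R : realType} {m : nat}.

Lemma sum_continuous (I : finType) (f : I -> 'rV[R]_m -> R) :
  (forall i, continuous (f i)) -> continuous (fun x => \sum_i f i x).
Proof.
move=> cf; apply: continuous_big => [|i _]; last exact: cf.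
exact: add_continuous.
Qed.

(** Expanding [x] in the standard basis turns [b (L x) (L x)] into a quadratic polynomial in the
    coordinates of [x], so no topology on [V] is involved. *)
Lemma hnorm_continuous {V : lmodType R} (b : {dot V for idfun})
    (L : {linear 'rV[R]_m -> V}) : continuous (fun x => hnorm b (L x)).
Proof.
have LE x : b (L x) (L x) =
    \sum_i \sum_j x 0 i * x 0 j * b (L 'e_i) (L 'e_j).
  rewrite {1 2}[x]row_sum_delta linear_sum linear_sumlz.
  apply: eq_bigr => i _; rewrite linear_sumr; apply: eq_bigr => j _.
  by rewrite !(linearZZ L) linearZl_LR linearZr_LR /= mulrA.
have cb : continuous (fun x => b (L x) (L x)).
  rewrite (funext LE); do 2![apply: sum_continuous => ?] => x.
  apply: (@continuousM _ _ _ _ x); last exact: cst_continuous.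
  by apply: (@continuousM _ _ _ _ x); exact: coord_continuous.
move=> x; apply: (@continuous_comp _ _ _ (fun x => b (L x) (L x)) _ x (cb x)).
exact: sqrt_continuous.
Qed.

Lemma dsum_norm_continuous {I : finType} {V : I -> lmodType R}
    (ip : forall i, {dot (V i) for idfun}) (L : {linear 'rV[R]_m -> dsum V}) :
  continuous (fun x => dsum_norm ip (L x)).
Proof.
move=> x; apply: (@continuous_comp _ _ _ (fun x => \sum_i hnorm (ip i) (L x i) ^+ 2)).
  apply: sum_continuous => {x} i x.
  have hc := @hnorm_continuous _ (ip i) (dsum_proj i \o L) x.
  exact: (continuousM hc hc).
exact: sqrt_continuous.
Qed.

Lemma stack_norm_continuous {I : finType} {X : I -> lmodType R} {U Y : lmodType R}
    (ipX : forall i, {dot (X i) for idfun}) (ipY : {dot Y for idfun})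
    (D : {linear U -> dsum X}) (A : {linear U -> Y}) (L : {linear 'rV[R]_m -> U}) :
  continuous (fun x => stack_norm ipX ipY (stack_op D A (L x))).
Proof.
move=> x; apply: (@continuous_comp _ _ _
  (fun x => dsum_norm ipX (D (L x)) ^+ 2 + hnorm ipY (A (L x)) ^+ 2)).
  have Dc := @dsum_norm_continuous _ _ ipX (D \o L) x.
  have Ac := @hnorm_continuous _ ipY (A \o L) x.
  exact: (continuousD (continuousM Dc Dc) (continuousM Ac Ac)).
exact: sqrt_continuous.
Qed.

End Continuity.

(** * Coordinates on the direct sum and minimization over sparse vectors *)

Section Coordinates.
Context {R : realType} {n : nat} {H : 'I_n -> vectType R}.
Variable ipH : forall i, {dot (H i) for idfun}.

(** A linear isomorphism: each slice of the row holds the coordinates of one block. Topological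
    arguments take place on the row side. *)
Definition dsum_of_row (x : 'rV[R]_(\sum_i dim (H i))) : dsum H :=
  [ffun i => r2v (submxrow x i)].

Fact dsum_of_row_linear : linear dsum_of_row.
Proof.
move=> a x y; apply/ffunP => i; rewrite dsumDE dsumZE !ffunE -linearP /=.
by congr r2v; apply/rowP => j; rewrite !mxE.
Qed.

HB.instance Definition _ := GRing.isLinear.Build R _ (dsum H) _ dsum_of_row
  dsum_of_row_linear.

Lemma dsum_of_row_surj h : exists x, dsum_of_row x = h.
Proof.
exists (\mxrow_i v2r (h i)); apply/ffunP => i.
by rewrite ffunE mxrowK v2rK.
Qed.

Lemma dsum_of_row_eq0 x : (dsum_of_row x == 0) = (x == 0).
Proof.
apply/eqP/eqP => [x0|->]; last exact: linear0.
apply/mxrowP => i; rewrite submxrow0; apply: (can_inj r2vK).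
by move/ffunP: x0 => /(_ i); rewrite ffunE dsum0E linear0.
Qed.

(* Group sparsity is lower semicontinuous: a nonzero block stays nonzero nearby. *)
Lemma gsparsity_closed s :
  closed [set x | (gsparsity (dsum_of_row x) <= s)%N].
Proof.
rewrite (_ : mkset _ = ~` [set x | s < gsparsity (dsum_of_row x)]%N); last first.
  by apply/seteqP; split=> x /=; [move=> /leq_gtF->|move=> /negP; rewrite -leqNgt].
rewrite closedC openE => x /= sx.
have : \forall y \near x, forall i, dsum_of_row x i != 0 -> dsum_of_row y i != 0.
  (* There are finitely many blocks, so one neighbourhood per block suffices; nonvanishing is tested
     on the norm of the block, which is continuous. *)
  apply: (filter_forall (nbhs_filter x)) => i; have [_|xi] := eqVneq (dsum_of_row x i) 0.
    exact: nearW.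
  have xi0 : hnorm (ipH i) (dsum_of_row x i) != 0 by rewrite gt_eqF ?hnorm_gt0.
  have ci := @hnorm_continuous R _ _ (ipH i) (dsum_proj i \o dsum_of_row) x.
  near=> y => _; have : hnorm (ipH i) (dsum_of_row y i) != 0.
    by near: y; exact: (cvgr_neq0 (FF := nbhs_filter x) _ ci xi0).
  apply: contraNneq => ->.
  by rewrite /hnorm linear0l sqrtr0.
apply: filterS => y xy; apply: leq_trans sx _.
by apply/subset_leq_card/fintype.subsetP => i; rewrite !inE; exact: xy.
Unshelve. all: by end_near. Qed.

(* Compactness is used on the unit sphere of the coordinate space for its
   sup-norm, which avoids comparing it with the norm of the direct sum. *)
Section SparseMinimum.
Variables (s : nat) (r : dsum H -> R).
Hypothesis r_cont : forall x, x != 0 -> {for x, continuous (r \o dsum_of_row)}.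
Hypothesis rZ : forall a h, a != 0 -> r (a *: h) = r h.

Lemma sparse_min : (exists h : dsum H, h != 0 /\ (gsparsity h <= s)%N) ->
  exists h : dsum H, [/\ h != 0, (gsparsity h <= s)%N &
    forall g : dsum H, g != 0 -> (gsparsity g <= s)%N -> r h <= r g].
Proof.
move=> [h [h0 hs]].
pose S := [set x | `|x| = 1 /\ (gsparsity (dsum_of_row x) <= s)%N].
(* Scaling changes neither the sparsity nor [r], so every competitor has a representative on the
   unit sphere. *)
have normalize g : g != 0 -> (gsparsity g <= s)%N ->
    exists2 x, S x & r (dsum_of_row x) = r g.
  move=> g0 gs; have [x xg] := dsum_of_row_surj g.
  have x0 : `|x| != 0 by rewrite normr_eq0 -dsum_of_row_eq0 xg.
  exists (`|x|^-1 *: x); last by rewrite linearZ /= xg rZ// invr_neq0.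
  split; first by rewrite normrZ normfV normr_id mulVf.
  by rewrite linearZ /= xg gsparsityZ// invr_neq0.
have S_neq0 x : S x -> x != 0.
  by move=> [x1 _]; rewrite -normr_eq0 x1 oner_neq0.
have cS : compact S.
  apply: bounded_closed_compact.
    by exists 1; split => // M M1 x [x1 _]; rewrite /= [X in X <= _]x1 ltW.
  have c1 : closed [set x : 'rV[R]_(\sum_i dim (H i)) | `|x| = 1].
    have /continuous_closedP nc := @norm_continuous R 'rV[R]_(\sum_i dim (H i)).
    exact: (nc _ (@closed_eq R 1)).
  exact: (closedI c1 (@gsparsity_closed s)).
have [x /set_mem Sx xmin] : exists2 x, x \in S &
    forall y, y \in S -> (r \o dsum_of_row) x <= (r \o dsum_of_row) y.
  apply: EVT_min_rV cS _.
    by have [x Sx _] := normalize _ h0 hs; exists x.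
  by apply: continuous_in_subspaceT => x /set_mem/S_neq0; exact: r_cont.
exists (dsum_of_row x); split; [|exact: Sx.2|].
  by rewrite dsum_of_row_eq0 S_neq0.
move=> g g0 gs; have [y Sy <-] := normalize _ g0 gs.
by apply: xmin; exact: mem_set.
Qed.
End SparseMinimum.
End Coordinates.

(** * Least elements, with the margin and the spark as genuine minima *)

Lemma setmin_in {d : Order.disp_t} {T : porderType d} (x0 : T) (S : set T) :
  S (setmin x0 S) \/ setmin x0 S = x0.
Proof. by rewrite /setmin; case: xgetP => [x _ [Sx _]|]; [left|right]. Qed.

Lemma setminP {d : Order.disp_t} {T : porderType d} (x0 x : T) (S : set T) :
  S x -> lbound S x -> (S `&` lbound S) (setmin x0 S).
Proof. by move=> Sx lbx; apply: (xgetPex x0); exists x. Qed.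

Section MarginSpark.
Context {R : realType} {n : nat} {H : 'I_n -> vectType R}.

(** The minimum is attained by [sparse_min], so [margin] is a true least element and not the default
    0. *)
Lemma margin_lbound {E : finType} {tgt : E -> 'I_n} {K : vectType R}
    (ipH : forall i, {dot (H i) for idfun}) (ipK : {dot K for idfun})
    (D : {linear dsum H -> dsum (fun e => H (tgt e))})
    (A : {linear dsum H -> K}) (k : nat) :
  (1 <= k)%N -> (exists h : dsum H, h != 0) ->
  let S := [set stack_norm (fun e => ipH (tgt e)) ipK (stack_op D A h)
             / dsum_norm ipH h
           | h in [set h : dsum H | h != 0 /\ (gsparsity h <= 2 * k)%N]] in
  (S `&` lbound S) (margin ipH ipK D A k).
Proof.
move=> k1 [h /dsum_neq0P[i hi]] S.
pose r h := stack_norm (fun e => ipH (tgt e)) ipK (stack_op D A h) / dsum_norm ipH h.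
have [|||g [g0 gs gmin]] := @sparse_min _ _ H ipH (2 * k) r.
- move=> x x0.
  have Nc := @dsum_norm_continuous _ _ _ _ ipH dsum_of_row x.
  have Bc := @stack_norm_continuous _ _ _ _ _ _
    (fun e => ipH (tgt e)) ipK D A dsum_of_row x.
  apply: (continuousM Bc (continuousV _ Nc)).
  by rewrite gt_eqF// dsum_norm_gt0// dsum_of_row_eq0.
- move=> a g a0; rewrite /r linearZ /= stack_normZ dsum_normZ.
  by rewrite -mulf_div divff ?normr_eq0// mul1r.
(* A competitor exists: keeping a single nonzero block of [h] gives sparsity at most 1, which is at
   most [2 * k] since [1 <= k]. *)
- pose g : dsum H := [ffun j => if j == i then h j else 0].
  exists g; split; first by apply/dsum_neq0P; exists i; rewrite ffunE eqxx.
  apply: (@leq_trans 1); last by rewrite muln_gt0.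
  rewrite -(cards1 i); apply/subset_leq_card/fintype.subsetP => j.
  by rewrite !inE ffunE; have [|_] := eqVneq j i; rewrite ?eqxx.
- apply: (@setminP _ _ 0 (r g)); first by exists g.
  by move=> _ [g' [g'0 g's] <-]; exact: gmin.
Qed.

(** Sparsities are natural numbers, so a nontrivial kernel has a sparsest nonzero vector by
    well-ordering, and the default [+oo] is not returned. *)
Lemma gspark_lbound {Y : lmodType R} (B : {linear dsum H -> Y}) h :
  h != 0 -> B h = 0 -> (gspark B <= ((gsparsity h)%:R)%:E)%E.
Proof.
move=> h0 Bh0.
pose P m := `[< exists g, [/\ g != 0, B g = 0 & gsparsity g = m] >].
have exP : exists m, P m by exists (gsparsity h); apply/asboolP; exists h.
case: (ex_minnP exP) => _ /asboolP[g [g0 Bg0 <-]] gmin.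
pose S : set (\bar R) := [set ((gsparsity h)%:R)%:E
          | h in [set h : dsum H | h != 0 /\ B h = 0]].
suff [_ lb] : (S `&` lbound S) (gspark B) by apply: lb; exists h.
apply: (@setminP _ _ +oo%E ((gsparsity g)%:R)%:E); first by exists g.
move=> _ [g' [g'0 Bg'0] <-]; rewrite lee_fin ler_nat; apply: gmin.
by apply/asboolP; exists g'.
Qed.

End MarginSpark.

(** * Equivalence of unique recovery, kernel, margin and spark conditions *)

Theorem theorem3 (R : realType) (n : nat) (E : finType) (src tgt : E -> 'I_n)
    (H : 'I_n -> vectType R) (ipH : forall i, {dot (H i) for idfun})
    (K : vectType R) (ipK : {dot K for idfun})
    (w : E -> R) (T : forall e, {linear H (src e) -> H (tgt e)})
    (A : {linear dsum H -> K}) (k : nat)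
    (H_neq0 : exists h : dsum H, h != 0)
    (w_gt0 : forall e, 0 < w e)
    (k_ge1 : (1 <= k)%N) :
  let D : {linear dsum H -> dsum (fun e => H (tgt e))} := edge_op w T in
  let B : {linear dsum H -> (dsum (fun e => H (tgt e)) * K)%type} := stack_op D A in
  [<-> forall es : dsum H, (gsparsity es <= k)%N ->
         [set e : dsum H | (gsparsity e <= k)%N /\ B e = B es] = [set es];
       ~ (exists h : dsum H, [/\ h != 0, B h = 0 & (gsparsity h <= 2 * k)%N]);
       0 < margin ipH ipK D A k;
       (((2 * k)%:R)%:E < gspark B)%E].
Proof.
move=> D B; tfae.
- move=> uniq_sol [h [h0 Bh0 hs]].
  have [g1 [g2 [g1s g2s hE]]] : exists g1 g2,
      [/\ (gsparsity g1 <= k)%N, (gsparsity g2 <= k)%N & h = g1 - g2].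
    by apply: gsparsity_split; rewrite addnn -mul2n.
  (* Uniqueness applied with [g2] as the true vector forces [g1 = g2], hence [h = 0]. *)
  have : [set e | (gsparsity e <= k)%N /\ B e = B g2] g1.
    by split => //; apply/eqP; rewrite -subr_eq0 -linearB -hE Bh0.
  by rewrite uniq_sol// => g12; move: h0; rewrite hE g12 subrr eqxx.
- move=> inj; have [[h [h0 hs] <-] _] := margin_lbound ipH ipK D A k_ge1 H_neq0.
  rewrite divr_gt0 ?dsum_norm_gt0// stack_norm_gt0//.
  by apply/eqP => Bh0; apply: inj; exists h.
- move=> margin_gt0; have [_ lb] := margin_lbound ipH ipK D A k_ge1 H_neq0.
  rewrite /gspark; set S := image _ _.
  (* Either the spark is the sparsity of a kernel vector, or it is the default [+oo], which exceeds
     [2 * k]. *)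
  have [[h [h0 Bh0] <-]|->] := setmin_in +oo%E S; last exact: ltry.
  rewrite lte_fin ltr_nat ltnNge; apply/negP => hs.
  have /(lt_le_trans margin_gt0) := lb _ (ex_intro2 _ _ h (conj h0 hs) erefl).
  (* Writing 0 as [0 *: B 0] lets homogeneity give norm 0, so the positive margin would be below
     0. *)
  rewrite -/B Bh0 -(scale0r (B 0)) stack_normZ normr0 !mul0r.
  by rewrite ltxx.
- move=> spark es ess; apply/seteqP; split=> [e [es' Bes]|_ ->//].
  apply/eqP; rewrite -subr_eq0; apply: contraT => h0.
  have Bh0 : B (e - es) = 0 by rewrite linearB Bes subrr.
  (* The difference would have more than [2 * k] nonzero blocks, but it has at most [k + k]. *)
  have := lt_le_trans spark (gspark_lbound h0 Bh0).
  rewrite lte_fin ltr_nat ltnNge (leq_trans (gsparsityB e es))//.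
  by rewrite mul2n -addnn leq_add.
Qed.
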